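(* The numbers $E_m(n)$ and $E_{\geq m}(n)$ defined in the context satisfy, for all integers $0\leq m<n$, the recurrence $$E_m(n)=\sum_{j=1}^m\sum_{i=1}^{n-m-1}\binom{n-m-1}{i-1}E_{\geq j}(i+j-1)\,E_{\geq m-j}(n-j-i),$$ with initial conditions $E_1(1)=1$ and $E_n(n)=0$ for all integers $n\ge 2$.
   Context: $S_n$ is the set of permutations of $\{1,\ldots,n\}$, written as words $\pi=\pi_1\cdots\pi_n$. The (West) stack-sorting map $s:S_n\to S_n$ is defined by the following procedure on an input $\pi=\pi_1\cdots\pi_n$, using an initially empty vertical stack. At any point in time, if there is a next entry of the input and either it is smaller than the entry at the top of the stack or the stack is empty, then that next entry is placed on top of the stack. Otherwise, the entry at the top of the stack is removed and appended to the end of the output. The procedure terminates when the output has length $n$, and $s(\pi)$ is this output. A permutation $\pi\in S_n$ is uniquely sorted if $|s^{-1}(\pi)|=1$. The tail length $\mathrm{tl}(\pi)$ of $\pi\in S_n$ is the smallest nonnegative integer $i$ such that $\pi_{n-i}\neq n-i$, where the identity permutation of $S_n$ is understood to have tail length $n$. $E_m(n)$ is the number of uniquely sorted permutations in $S_n$ with tail length $m$, and $E_{\geq m}(n)=\sum_{\ell=m}^nE_\ell(n)$. Empty sums equal $0$. *)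

(* Defs.v *)
From mathcomp Require Import all_boot fingroup perm zify ring.

Set Implicit Arguments.
Unset Strict Implicit.
Unset Printing Implicit Defensive.

(* A state of the sorting machine is (remaining input, stack, output); the
   head of the stack list is the top of the stack. *)
Definition sort_step (c : seq nat * seq nat * seq nat) :
    seq nat * seq nat * seq nat :=
  match c with
  | (x :: inp, [::], out) => (inp, [:: x], out)
  | (x :: inp, y :: st, out) =>
      if x < y then (inp, x :: y :: st, out) else (x :: inp, st, rcons out y)
  | ([::], y :: st, out) => ([::], st, rcons out y)
  | ([::], [::], out) => ([::], [::], out)
  end.

(* Each entry is pushed once and popped once, so the procedure stops after
   exactly 2 * size w steps; see stack_sort_halts. *)
Definition stack_sort (w : seq nat) : seq nat :=
  (iter (2 * size w) sort_step (w, [::], [::])).2.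

Lemma stack_sort_halts (w : seq nat) :
  iter (2 * size w) sort_step (w, [::], [::]) = ([::], [::], stack_sort w).
Proof.
rewrite /stack_sort.
have H k c : 2 * size c.1.1 + size c.1.2 <= k ->
    (iter k sort_step c).1 = ([::], [::]).
  elim: k c => [|k IH] [[[|x inp] [|y st]] out]; rewrite ?iterSr //=;
    try (by move=> ?; exfalso; lia); try case: ifP => _;
    by move=> le_k; apply: IH => /=; lia.
rewrite [LHS]surjective_pairing H //=; lia.
Qed.

Lemma perm_stack_sort (w : seq nat) : perm_eq (stack_sort w) w.
Proof.
have step c : perm_eq ((sort_step c).1.1 ++ (sort_step c).1.2 ++ (sort_step c).2)
    (c.1.1 ++ c.1.2 ++ c.2).
  apply/seq.permP => a.
  have consE x s : count a (x :: s) = a x + count a s by [].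
  have nilE : count a [::] = 0 by [].
  case: c => [[[|x inp] [|y st]] out]; cbn [sort_step fst snd];
    try case: ifP => _; cbn [fst snd];
    by rewrite -?cats1 !(count_cat, consE, nilE); ring.
have H k c : perm_eq ((iter k sort_step c).1.1 ++
    (iter k sort_step c).1.2 ++ (iter k sort_step c).2)
    (c.1.1 ++ c.1.2 ++ c.2).
  by elim: k => //= k; apply: perm_trans.
have := H (2 * size w) (w, [::], [::]).
by rewrite stack_sort_halts /= cats0.
Qed.

(* The word pi_1 ... pi_n in the letters 1, ..., n; 'S_n acts on 0, ..., n-1. *)
Definition word (n : nat) (p : 'S_n) : seq nat :=
  [seq (val (p i)).+1 | i <- enum 'I_n].

Lemma word_inj (n : nat) : injective (@word n).
Proof.
move=> p q /eq_in_map eq_pq; apply/permP => i; apply/val_inj/succn_inj.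
by apply: eq_pq; rewrite mem_enum.
Qed.

Lemma perm_word (n : nat) (p : 'S_n) : perm_eq (word p) (iota 1 n).
Proof.
have -> : iota 1 n = [seq i.+1 | i <- iota 0 n] by rewrite -(iotaDl 1 0 n).
rewrite -val_enum_ord -map_comp.
have -> : word p = [seq (val i).+1 | i <- [seq p i | i <- enum 'I_n]].
  by rewrite -map_comp.
apply/perm_map/uniq_perm; rewrite ?(map_inj_uniq perm_inj) ?enum_uniq // => i.
rewrite mem_enum; apply/mapP; exists ((p^-1)%g i); by rewrite ?mem_enum ?permKV.
Qed.

Lemma word_onto (n : nat) (w : seq nat) :
  perm_eq w (iota 1 n) -> exists p : 'S_n, word p == w.
Proof.
move=> pw; have szw : size w = n by rewrite (perm_size pw) size_iota.
have w_in (i : 'I_n) : 0 < nth 0 w i <= n.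
  have : nth 0 w i \in iota 1 n by rewrite -(perm_mem pw) mem_nth ?szw.
  by rewrite mem_iota; lia.
have lt_w (i : 'I_n) : (nth 0 w i).-1 < n by have := w_in i; lia.
have inj_w : injective (fun i => Ordinal (lt_w i)).
  move=> i j /(congr1 val) /= eq_w; case/andP: (w_in i) => wi _.
  case/andP: (w_in j) => wj _; apply/val_inj/eqP.
  have eq_ij : nth 0 w i = nth 0 w j.
    by rewrite -(prednK wi) -(prednK wj) eq_w.
  have uw : uniq w by rewrite (perm_uniq pw) iota_uniq.
  have /= <- := @nth_uniq _ 0 w i j _ _ uw; rewrite ?szw ?ltn_ord //.
  exact/eqP.
exists (perm inj_w); apply/eqP/(@eq_from_nth _ 0).
  by rewrite size_map size_enum_ord.
move=> i; rewrite size_map size_enum_ord => lt_i.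
rewrite (nth_map (Ordinal lt_i)) ?size_enum_ord // permE /= nth_enum_ord //.
by rewrite prednK //; case/andP: (w_in (Ordinal lt_i)).
Qed.

Lemma stack_sort_word (n : nat) (p : 'S_n) :
  exists q : 'S_n, word q == stack_sort (word p).
Proof.
by apply: word_onto; apply: perm_trans (perm_stack_sort _) (perm_word p).
Qed.

(* By word_inj, the choice below is among a single candidate. *)
Definition stack_sort_perm (n : nat) (p : 'S_n) : 'S_n :=
  xchoose (stack_sort_word p).

Lemma word_stack_sort_perm (n : nat) (p : 'S_n) :
  word (stack_sort_perm p) = stack_sort (word p).
Proof. exact/eqP/(xchooseP (stack_sort_word p)). Qed.

Definition uniquely_sorted (n : nat) (p : 'S_n) : bool :=
  #|@stack_sort_perm n @^-1: [set p]| == 1.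

(* The letter pi_k sits at index k - 1 of the word. For the identity, find
   returns the length n of the list searched. *)
Definition tail_length (n : nat) (p : 'S_n) : nat :=
  find (fun i => nth 0 (word p) (n - i - 1) != n - i) (iota 0 n).

Definition E (m n : nat) : nat :=
  #|[set p : 'S_n | uniquely_sorted p & tail_length p == m]|.

Definition E_ge (m n : nat) : nat := \sum_(m <= l < n.+1) E l n.

(* Main.v *)
(** Write [fert w] for the number of preimages of a word under stack-sorting.
    Since [s(L n R) = s(L) s(R) n], [fert] satisfies a Catalan-like convolution,
    and convolving along a word [A v B T], where [v] exceeds [A] and [B] and [T]
    is an increasing run above [v], gives the decomposition over the possible
    northeast endpoints [t_j] of the hook at [v]:
    [fert (A v B T) = sum_j fert (A v T_(>j)) * fert (B T_(<j))].
    By induction along it, a sorted word of length [n] has at most [(n-1)/2]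
    descents, with equality exactly when it has a single preimage. The number of
    descents on each side of the hook does not depend on [j], so for a uniquely
    sorted word only one [j] contributes; hence the indicator of unique
    sortedness satisfies the same decomposition. Summing it over all words with
    [v = n - m] and grouping them by the set of letters of [A] gives the
    recurrence. *)

Require Import Defs.
From mathcomp Require Import all_boot.
From mathcomp Require Import fingroup perm zify.

Set Implicit Arguments.
Unset Strict Implicit.
Unset Printing Implicit Defensive.

(** * The fertility recursion *)

Lemma iter_step_out o k inp st out :
  iter k sort_step (inp, st, o ++ out) =
  ((iter k sort_step (inp, st, out)).1,
   o ++ (iter k sort_step (inp, st, out)).2).
Proof.
elim: k inp st out => [//|k IH] [|x inp] [|y st] out; rewrite !iterSr /=;
  try case: ifP => _; by rewrite ?rcons_cat IH.
Qed.

(** [n] cannot be pushed before the stack is empty, so until then it acts as the end of the input.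
    The step count is two per input letter and one pop per stacked letter. *)
Lemma iter_step_before n R inp st out : all (ltn^~ n) st ->
  all (ltn^~ n) inp ->
  iter (2 * size inp + size st) sort_step (inp ++ n :: R, st, out) =
  (n :: R, [::], (iter (2 * size inp + size st) sort_step (inp, st, out)).2).
Proof.
move Dk: (_ + _) => k; elim: k inp st out Dk => [|k IH] [|x inp] [|y st] out //=.
- move=> Dk /andP[lt_y lt_st] _; rewrite -!iterS !iterSr /= ltnNge ltnW //=.
  by rewrite (IH [::]) //=; lia.
- by move=> Dk _ /andP[lt_x lt_inp]; rewrite -!iterS !iterSr /= IH /= ?lt_x //; lia.
move=> Dk /andP[lt_y lt_st] /andP[lt_x lt_inp]; rewrite -!iterS !iterSr /=.
case: ifP => _; first by rewrite IH /= ?lt_x ?lt_y //; lia.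
by rewrite (IH (x :: inp)) /= ?lt_x //; lia.
Qed.

(** No smaller letter can pop an [n] at the bottom, so it acts as the empty stack; the count stops
    just before [n] itself would leave. *)
Lemma iter_step_above n inp st out : all (ltn^~ n) st -> all (ltn^~ n) inp ->
  iter (2 * size inp + size st) sort_step (inp, rcons st n, out) =
  ([::], [:: n], (iter (2 * size inp + size st) sort_step (inp, st, out)).2).
Proof.
move Dk: (_ + _) => k; elim: k inp st out Dk => [|k IH] [|x inp] [|y st] out //=.
- by move=> Dk /andP[lt_y lt_st] _; rewrite -!iterS !iterSr /= IH //=; lia.
- move=> Dk _ /andP[lt_x lt_inp]; rewrite -!iterS !iterSr /= lt_x.
  by rewrite (IH inp [:: x]) /= ?lt_x //; lia.
move=> Dk /andP[lt_y lt_st] /andP[lt_x lt_inp]; rewrite -!iterS !iterSr /=.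
case: ifP => _; first by rewrite (IH inp [:: x, y & st]) /= ?lt_x ?lt_y //; lia.
by rewrite (IH (x :: inp)) /= ?lt_x //; lia.
Qed.

Lemma stack_sort_max L R n : all (ltn^~ n) L -> all (ltn^~ n) R ->
  stack_sort (L ++ n :: R) = rcons (stack_sort L ++ stack_sort R) n.
Proof.
move=> ltL ltR; rewrite /stack_sort size_cat /=.
(* The two isolated steps push [n], right after [L] has been output, and pop it at the very end. *)
have -> : 2 * (size L + (size R).+1) = (2 * size R).+2 + 2 * size L by lia.
have := @iter_step_before n R L [::] [::] isT ltL; rewrite addn0 => eqL.
rewrite iterD eqL iterS iterSr /=.
set out := (iter _ _ _).2.
have := @iter_step_above n R [::] out isT ltR; rewrite addn0 /= => -> /=.
by have := iter_step_out out (2 * size R) R [::] [::]; rewrite cats0 => ->.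
Qed.

(** By [perm_stack_sort] every preimage of [w] rearranges [w], so this finite list misses none. *)
Definition fert (w : seq nat) : nat :=
  count (fun u => stack_sort u == w) (permutations w).

Lemma split_max (n : nat) (s u : seq nat) : n \notin s -> perm_eq u (rcons s n) ->
  exists L R, [/\ u = L ++ n :: R, perm_eq (L ++ R) s & n \notin L ++ R].
Proof.
move=> n_s pu.
have /path.splitPr : n \in u by rewrite (perm_mem pu) mem_rcons mem_head.
move=> Du; case: Du pu => L R pu; exists L, R.
have pLR : perm_eq (L ++ R) s.
  by move: pu; rewrite perm_catC /= perm_sym perm_rcons perm_cons perm_sym (perm_catC R).
by split; rewrite ?(perm_mem pLR).
Qed.

(** By [stack_sort_max] an output ends in its largest letter. *)
Lemma fert_not_last (A : seq nat) v (B : seq nat) :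
  B != [::] -> all (ltn^~ v) A -> all (ltn^~ v) B ->
  fert (A ++ v :: B) = 0.
Proof.
case/lastP: B => // B b _ ltA ltB; apply/eqP; rewrite -leqn0 leqNgt -has_count.
apply/negP => /hasP[u]; rewrite mem_permutations => pu /eqP Du.
have ltAB : all (ltn^~ v) (A ++ rcons B b) by rewrite all_cat ltA.
have [||L [R [Du' pLR _]]] := @split_max v (A ++ rcons B b) u.
- by apply/negP => /(allP ltAB) /=; rewrite ltnn.
- by apply: (perm_trans pu); rewrite perm_catC /= perm_sym perm_rcons perm_cons perm_catC.
have : all (ltn^~ v) (L ++ R) by rewrite (perm_all _ pLR).
rewrite all_cat => /andP[ltL ltR].
move: Du; rewrite Du' stack_sort_max // => /(congr1 (last 0)).
rewrite last_rcons last_cat /= last_rcons => Db.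
by move: ltB; rewrite all_rcons -Db /= ltnn.
Qed.

Lemma sum_fibers (T : eqType) (s : seq T) (P : pred T) (f : T -> nat) G N :
  (forall x, x \in s -> P x -> f x < N) ->
  \sum_(x <- s | P x) G x =
  \sum_(0 <= k < N) \sum_(x <- s | P x && (f x == k)) G x.
Proof.
elim: s => [|x s IH] ltf; first by rewrite big_nil big1 // => k _; rewrite big_nil.
rewrite big_cons IH; last by move=> y ys; apply: ltf; rewrite inE ys orbT.
have [Px|nPx] := boolP (P x); last first.
  by apply: eq_bigr => k _; rewrite big_cons (negbTE nPx).
have lt_fx := ltf x (mem_head _ _) Px.
transitivity (\sum_(0 <= k < N) ((if f x == k then G x else 0) +
   \sum_(y <- s | P y && (f y == k)) G y)).
  rewrite big_split /=; congr (_ + _).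
  rewrite -big_mkcond /= (big_rem (f x)) ?mem_index_iota //= eqxx big_seq_cond big1 ?addn0 //.
  move=> k /andP[]; rewrite mem_rem_uniq ?iota_uniq // inE => /andP[/eqP nk _] /eqP ek.
  by rewrite ek in nk.
by apply: eq_bigr => k _; rewrite big_cons Px /=; case: eqP.
Qed.

(** A preimage is [L ++ n :: R] with [stack_sort L ++ stack_sort R = s]; the position [k] of [n]
    cuts [s] into two outputs with independent preimages. *)
Lemma fert_rcons s n : all (ltn^~ n) s ->
  fert (rcons s n) =
  \sum_(0 <= k < (size s).+1) fert (take k s) * fert (drop k s).
Proof.
move=> lts; rewrite /fert -sum1_count.
have n_s : n \notin s by apply/negP => /(allP lts) /=; rewrite ltnn.
rewrite (@sum_fibers _ _ _ (index n) _ (size s).+1); last first.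
  move=> u; rewrite mem_permutations => pu _.
  by rewrite -(size_rcons s n) -(perm_size pu) index_mem (perm_mem pu) mem_rcons mem_head.
rewrite !big_mkord; apply: eq_bigr => -[k lt_k] _ /=.
rewrite sum1_count -!size_filter -(size_allpairs (fun L R => L ++ n :: R)).
have stackmem t u : (u \in [seq u <- permutations t | stack_sort u == t]) =
    (stack_sort u == t).
  rewrite mem_filter mem_permutations andb_idr // => /eqP <-.
  by rewrite perm_sym perm_stack_sort.
apply/perm_size/uniq_perm; first exact/filter_uniq/permutations_uniq.
  apply: allpairs_uniq; rewrite ?filter_uniq ?permutations_uniq //.
  move=> [L R] [L' R'] /allpairsP[[L1 R1] /= [L1k _ [-> _]]].
  move=> /allpairsP[[L2 R2] /= [L2k _ [-> _]]] /eqP.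
  move: L1k L2k; rewrite !stackmem => /eqP eL1 /eqP eL2.
  rewrite eqseq_cat; last first.
    rewrite -(perm_size (perm_stack_sort L1)) eL1 -eL2.
    exact/perm_size/perm_stack_sort.
  by rewrite eqseq_cons eqxx /= => /andP[/eqP -> /eqP ->].
move=> u; apply/idP/allpairsP => [|[[L R] /=]].
  rewrite mem_filter mem_permutations -andbA => /and3P[/eqP eu /eqP ek pu].
  have [L [R [Du pLR]]] := split_max n_s pu; rewrite mem_cat => /norP[nL nR].
  have : all (ltn^~ n) (L ++ R) by rewrite (perm_all _ pLR).
  rewrite all_cat => /andP[ltL ltR]; exists (L, R); rewrite !stackmem /=.
  move: eu ek; rewrite Du stack_sort_max // index_cat (negbTE nL) /= eqxx addn0.
  case/rcons_inj => <- <-; rewrite -(perm_size (perm_stack_sort L)).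
  by rewrite take_size_cat // drop_size_cat.
rewrite !stackmem => -[/eqP eL /eqP eR ->].
have : all (ltn^~ n) (L ++ R).
  rewrite -(perm_all _ (perm_cat (perm_stack_sort L) (perm_stack_sort R))).
  by rewrite eL eR cat_take_drop.
rewrite all_cat => /andP[ltL ltR].
have nL : n \notin L by apply/negP => /(allP ltL) /=; rewrite ltnn.
have eu : stack_sort (L ++ n :: R) = rcons s n.
  by rewrite stack_sort_max // eL eR cat_take_drop.
rewrite mem_filter mem_permutations eu eqxx /= -eu perm_sym perm_stack_sort andbT.
rewrite index_cat (negbTE nL) /= eqxx addn0 -(perm_size (perm_stack_sort L)) eL.
by rewrite size_take_min; apply/eqP/minn_idPl.
Qed.

(** * The decomposition along a hook *)

Lemma splits_cat (T : Type) (G : seq T -> seq T -> nat) x y :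
  \sum_(0 <= k < (size (x ++ y)).+1) G (take k (x ++ y)) (drop k (x ++ y)) =
  \sum_(0 <= k < size x) G (take k x) (drop k x ++ y) +
  \sum_(0 <= k < (size y).+1) G (x ++ take k y) (drop k y).
Proof.
rewrite (big_cat_nat _ (n := size x)) //=; last by rewrite size_cat; lia.
congr (_ + _).
  rewrite big_seq [RHS]big_seq; apply: eq_bigr => k.
  rewrite mem_index_iota => /andP[_ lt_k].
  by rewrite take_cat drop_cat lt_k.
rewrite -{1}[size x]add0n big_addn size_cat -addnS addKn.
apply: eq_bigr => k _; rewrite take_cat drop_cat.
by rewrite ltnNge leq_addl addnK.
Qed.

(** The sums are exchanged and [k] is written as [l + j.+1]. *)
Lemma sum_triangle m (a : nat -> nat -> nat) :
  \sum_(0 <= k < m.+1) \sum_(0 <= j < k) a k j =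
  \sum_(0 <= j < m) \sum_(0 <= l < m - j) a (l + j.+1) j.
Proof.
transitivity (\sum_(0 <= k < m.+1) \sum_(0 <= j < m | j < k) a k j).
  rewrite big_seq [RHS]big_seq; apply: eq_bigr => k.
  by rewrite mem_index_iota => /andP[_ lt_k]; rewrite (big_nat_widen _ _ m).
rewrite (exchange_big_dep_nat xpredT) //=; apply: eq_bigr => j _.
transitivity (\sum_(j.+1 <= k < m.+1) a k j).
  rewrite [RHS](big_nat_widenl _ 0) //; exact: eq_bigl.
by rewrite -[in LHS](add0n j.+1) big_addn subSS.
Qed.

Lemma dropl_cat (T : Type) k (x y : seq T) :
  k <= size x -> drop k (x ++ y) = drop k x ++ y.
Proof.
by rewrite leq_eqVlt drop_cat => /predU1P[->|->] //; rewrite ltnn subnn drop0 drop_size.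
Qed.

Lemma all_take (T : Type) (a : pred T) k s : all a s -> all a (take k s).
Proof. by rewrite -{1}(cat_take_drop k s) all_cat => /andP[]. Qed.

Lemma all_drop (T : Type) (a : pred T) k s : all a s -> all a (drop k s).
Proof. by rewrite -{1}(cat_take_drop k s) all_cat => /andP[]. Qed.

(** Induction on the size of [T]: its last letter [t] is the largest of the word, [fert_rcons] cuts
    the rest at every place, and the induction hypothesis applies to the side that still contains
    [v] and all of [B]. *)
Lemma fert_decomp (A : seq nat) v (B T : seq nat) :
  B != [::] -> all (ltn^~ v) A -> all (ltn^~ v) B -> path ltn v T ->
  fert (A ++ v :: B ++ T) =
  \sum_(0 <= j < size T) fert (A ++ v :: drop j.+1 T) * fert (B ++ take j T).
Proof.
move=> B0 + ltB; have [n] := ubnP (size T).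
elim: n A T => // n IH A T; case/lastP: T => [|T t].
  by move=> _ ltA _; rewrite cats0 big_nil fert_not_last.
rewrite size_rcons ltnS => lt_n ltA; rewrite rcons_path => /andP[pT ltt].
have IH' A' k : all (ltn^~ v) A' ->
    fert (A' ++ v :: B ++ take k T) =
    \sum_(0 <= j < size (take k T))
       fert (A' ++ v :: drop j.+1 (take k T)) * fert (B ++ take j (take k T)).
  move=> ltA'; apply: IH => //; last exact: take_path.
  by rewrite size_take_min; lia.
have allT : all (ltn^~ t) (v :: T).
  have : sorted ltn (rcons (v :: T) t) by rewrite /= rcons_path pT.
  by rewrite (sorted_pairwise ltn_trans) pairwise_rcons => /andP[].
have ltvt : v < t by case/andP: allT.
have sub X : all (ltn^~ v) X -> all (ltn^~ t) X.
  by apply: sub_all => x /= ltx; apply: ltn_trans ltvt.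
have -> : A ++ v :: B ++ rcons T t = rcons ((A ++ [:: v]) ++ B ++ T) t.
  by rewrite rcons_cat -catA /= rcons_cat.
have front Y : \sum_(0 <= k < size (A ++ [:: v]))
      fert (take k (A ++ [:: v])) * fert (drop k (A ++ [:: v]) ++ Y) =
    \sum_(0 <= k < (size A).+1) fert (take k A) * fert (drop k A ++ v :: Y).
  rewrite size_cat /= addn1 big_seq [RHS]big_seq; apply: eq_bigr => k.
  rewrite mem_index_iota ltnS => /andP[_ le_k].
  by rewrite takel_cat // dropl_cat // -catA.
have split_top Y : all (ltn^~ t) Y -> fert (rcons ((A ++ [:: v]) ++ Y) t) =
    \sum_(0 <= k < (size A).+1) fert (take k A) * fert (drop k A ++ v :: Y) +
    \sum_(0 <= k < (size Y).+1) fert ((A ++ [:: v]) ++ take k Y) * fert (drop k Y).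
  move=> ltY; rewrite fert_rcons; last by rewrite !all_cat (sub _ ltA) /= ltvt.
  by rewrite (splits_cat (fun x y => fert x * fert y)) front.
have ltT : all (ltn^~ t) T by case/andP: allT.
rewrite split_top; last by rewrite all_cat (sub _ ltB).
rewrite (splits_cat (fun x y => fert (_ ++ x) * fert y)).
(* A cut inside [B] leaves [v] as a maximum that is not last, so only the cut right after [v]
   survives. *)
have -> : \sum_(0 <= k < size B)
    fert ((A ++ [:: v]) ++ take k B) * fert (drop k B ++ T) =
    fert (A ++ [:: v]) * fert (B ++ T).
  rewrite big_ltn ?lt0n ?size_eq0 // take0 cats0 drop0.
  rewrite big_seq big1 ?addn0 // => k; rewrite mem_index_iota => /andP[k_gt0 lt_k].
  rewrite -catA /= fert_not_last // ?all_take //.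
  by rewrite -size_eq0 size_takel // -?lt0n // ltnW.
(* The surviving cut is the summand whose hook ends at [t]. *)
rewrite -cats1 [RHS]big_nat_recr //= take_size_cat //.
rewrite [drop (size T).+1 _]drop_oversize ?size_cat ?addn1 //.
rewrite addnCA [RHS]addnC; congr (_ + _).
(* In the other summands the word outside the hook still ends in [t] and is expanded by its own
   cuts. *)
transitivity (\sum_(0 <= j < size T)
  (\sum_(0 <= k < (size A).+1)
     fert (take k A) * fert (drop k A ++ v :: drop j.+1 T) +
   \sum_(0 <= k < (size (drop j.+1 T)).+1)
      fert ((A ++ [:: v]) ++ take k (drop j.+1 T)) * fert (drop k (drop j.+1 T))) *
   fert (B ++ take j T)); last first.
  rewrite big_seq [RHS]big_seq; apply: eq_bigr => j.
  rewrite mem_index_iota => /andP[_ lt_j].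
  rewrite takel_cat 1?ltnW // dropl_cat // -split_top ?all_drop //.
  by rewrite rcons_cat -catA /= cats1.
under [RHS]eq_bigr do rewrite mulnDl.
rewrite big_split /=; congr (_ + _).
  (* Cuts before [v]: the induction hypothesis with [drop k A] for [A]. *)
  under [RHS]eq_bigr do rewrite big_distrl.
  rewrite /= exchange_big /=; apply: eq_bigr => k _.
  rewrite -{1}[T]take_size IH' ?all_drop // take_size big_distrr /=.
  by apply: eq_bigr => j _; rewrite mulnA.
(* Cuts behind [B]: the cut follows [k] letters of [T], and the hook ends at index [j < k]. *)
pose a k j := fert (A ++ v :: drop j.+1 (take k T)) *
  fert (B ++ take j T) * fert (drop k T).
transitivity (\sum_(0 <= k < (size T).+1) \sum_(0 <= j < k) a k j).
  rewrite big_seq [RHS]big_seq; apply: eq_bigr => k.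
  rewrite mem_index_iota => /andP[_ le_k].
  rewrite -!catA /= IH' // size_takel // big_distrl /= big_seq [RHS]big_seq.
  apply: eq_bigr => j; rewrite mem_index_iota => /andP[_ lt_j].
  by rewrite take_takel 1?ltnW.
rewrite sum_triangle big_seq [RHS]big_seq; apply: eq_bigr => j.
rewrite mem_index_iota => /andP[_ lt_j].
rewrite big_distrl size_drop /= subnSK //; apply: eq_bigr => l _.
by rewrite /a take_drop drop_drop -catA mulnAC.
Qed.

(** * Descents of sorted words *)

Lemma sorted_ltn_last s x : sorted ltn (rcons s x) = all (ltn^~ x) s && sorted ltn s.
Proof. by rewrite !(sorted_pairwise ltn_trans) pairwise_rcons. Qed.

(** Each of the two extreme cuts in [fert_rcons] contributes the positive fertility of the shorter
    word; they differ unless that word is empty. *)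
Lemma fert_sorted w : sorted ltn w ->
  0 < fert w /\ (w != [::] -> (fert w == 1) = (size w == 1)).
Proof.
elim/last_ind: w => [//|s n IH]; rewrite sorted_ltn_last => /andP[lts sorts].
have [fert_s _] := IH sorts; rewrite fert_rcons // size_rcons.
rewrite big_nat_recl // take0 drop0 mul1n; split=> [|_]; first by rewrite ltn_addr.
case: s {IH sorts lts} fert_s => [|x s] fert_s; first by rewrite big_nil.
rewrite big_nat_recr //= take_size drop_size muln1; apply/negbTE.
by rewrite neq_ltn; lia.
Qed.

Lemma max_split (s : seq nat) : uniq s -> s != [::] ->
  exists A v B, [/\ s = A ++ v :: B, all (ltn^~ v) A & all (ltn^~ v) B].
Proof.
elim: s => // x [|y s] IH /andP[x_s us] _; first by exists [::], x, [::].
have [//|A [v [B [Ds ltA ltB]]]] := IH us; rewrite Ds in x_s *.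
have [lt_xv|lt_vx|eq_xv] := ltngtP x v.
- by exists (x :: A), v, B; split=> //=; rewrite lt_xv.
- exists [::], x, (A ++ v :: B); split=> //; rewrite all_cat /= lt_vx.
  by apply/andP; split; [move: ltA|move: ltB]; apply: sub_all => z /= lt_z;
    apply: ltn_trans lt_vx.
- by rewrite eq_xv mem_cat mem_head orbT in x_s.
Qed.

(** While the largest letter stands last, it is moved to [T]; the first maximum found elsewhere is
    [v]. *)
Lemma tail_split (w : seq nat) : uniq w -> sorted ltn w \/
  exists A v B T, [/\ w = A ++ v :: B ++ T, B != [::],
    all (ltn^~ v) A, all (ltn^~ v) B & path ltn v T].
Proof.
have [n] := ubnP (size w); elim: n w => // n IH w lt_n uw.
have [->|w0] := eqVneq w [::]; first by left.
have [A [v [B [Dw ltA ltB]]]] := max_split uw w0.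
have [B0|B0] := eqVneq B [::]; last first.
  by right; exists A, v, B, [::]; rewrite cats0.
move: lt_n uw; rewrite Dw B0 cats1 size_rcons rcons_uniq ltnS => lt_n /andP[_ uA].
have [sA|[A' [v' [B' [T [DA B'0 ltA' ltB' pT]]]]]] := IH A lt_n uA.
  by left; rewrite sorted_ltn_last ltA.
right; exists A', v', B', (rcons T v); split=> //.
  by rewrite DA rcons_cat /= rcons_cat.
rewrite rcons_path pT /=; apply: (allP ltA).
by rewrite DA mem_cat -cat_cons mem_cat; case: T {DA pT} => [|y T] /=;
  rewrite ?mem_head ?mem_last ?orbT.
Qed.

(* The initial 0 is never followed by a descent. *)
Definition des (w : seq nat) : nat := count id (pairmap (fun x y => y < x) 0 w).

Lemma count_desc_path x s : path ltn x s ->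
  count id (pairmap (fun x y => y < x) x s) = 0.
Proof.
elim: s x => //= y s IH x /andP[lt_xy /IH ->].
by rewrite ltnNge ltnW.
Qed.

Lemma des_max_ascend A v T : all (ltn^~ v) A -> path ltn v T ->
  des (A ++ v :: T) = des A.
Proof.
move=> ltA pT; rewrite /des pairmap_cat count_cat /= (count_desc_path pT).
have -> : v < last 0 A = false.
  have : last 0 A \in 0 :: A by rewrite mem_last.
  by rewrite inE => /predU1P[->//|/(allP ltA) /= lt_v]; apply/negbTE; lia.
by rewrite !addn0.
Qed.

Lemma des_ascend B v T : all (ltn^~ v) B -> path ltn v T -> des (B ++ T) = des B.
Proof.
move=> ltB; case: T => [|t T] /=; first by rewrite cats0.
move=> /andP[lt_vt pT]; apply: des_max_ascend => //.
by apply: sub_all ltB => x /= lt_x; apply: ltn_trans lt_vt.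
Qed.

(** The extra descent leads from [v] into [B]; none enters [v] or a letter of [T]. *)
Lemma des_descent (A : seq nat) v (B T : seq nat) :
  B != [::] -> all (ltn^~ v) A -> all (ltn^~ v) B -> path ltn v T ->
  des (A ++ v :: B ++ T) = (des A + des B).+1.
Proof.
move=> B0 ltA ltB pT; rewrite -(des_ascend ltB pT).
case: B B0 ltB => // b B _ /andP[/= lt_bv _].
rewrite -(@des_max_ascend A v [::] ltA isT) /des !pairmap_cat !count_cat /=.
by rewrite lt_bv addn0 -addnS addnA.
Qed.

(** A term equal to 1 excludes every other positive term, so the sum is 1 as soon as one term is.
    This carries the test for 1 through the sum. *)
Lemma sum_eq1 m (h : nat -> nat) :
  (forall i j, i < m -> j < m -> h i = 1 -> 0 < h j -> j = i) ->
  (\sum_(0 <= j < m) h j == 1) = \sum_(0 <= j < m) (h j == 1) :> nat.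
Proof.
rewrite !big_mkord => uh.
case: (pickP (fun j : 'I_m => h j == 1)) => [i /eqP hi|h0].
  have rest (j : 'I_m) : j != i -> h j = 0.
    move=> /negP ji; apply/eqP; rewrite -leqn0 leqNgt; apply/negP => hj.
    by case: ji; apply/eqP/val_inj; apply: uh hi hj.
  rewrite (bigD1 i) //= (bigD1 (F := fun j => nat_of_bool _) i) //= hi.
  by rewrite !big1 // => j /rest ->.
rewrite [RHS]big1 => [|j _]; last by rewrite h0.
by apply/eqP; rewrite eqb0; apply/negP => /sum_nat_eq1[j [_ /eqP]]; rewrite h0.
Qed.

Definition uniq_sorted (w : seq nat) : bool := fert w == 1.

(** The bound on descents and its equality case, doubled to avoid division. *)
Definition tight (w : seq nat) := 0 < fert w ->
  2 * des w < size w /\ uniq_sorted w = (2 * des w + 1 == size w).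

Section HookDecomposition.

Variables (A : seq nat) (v : nat) (B T : seq nat).
Hypotheses (B0 : B != [::]) (ltA : all (ltn^~ v) A) (ltB : all (ltn^~ v) B).
Hypothesis pT : path ltn v T.

(* The words outside and under the hook from [v] to the [j]-th letter of [T]. *)
Let U j := A ++ v :: drop j.+1 T.
Let S j := B ++ take j T.

Lemma des_unsheltered j : des (U j) = des A.
Proof.
apply: des_max_ascend => //; move: pT; rewrite !(path_sortedE ltn_trans).
by move=> /andP[/(all_drop j.+1)-> /(drop_sorted j.+1)].
Qed.

Lemma des_sheltered j : des (S j) = des B.
Proof. exact/(des_ascend ltB)/take_path. Qed.

Hypothesis tightU : forall j, j < size T -> tight (U j).
Hypothesis tightS : forall j, j < size T -> tight (S j).

(** [U j] has [size A + size T - j] letters and [S j] has [size B + j]; these are their tightness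
    statements with the subtraction moved across. *)
Lemma hook_bounds j : j < size T -> 0 < fert (U j) * fert (S j) ->
  [/\ 2 * des A + j < size A + size T, 2 * des B < size B + j &
      (fert (U j) * fert (S j) == 1) =
      (2 * des A + j + 1 == size A + size T) && (2 * des B + 1 == size B + j)].
Proof.
move=> lt_j; rewrite muln_gt0 muln_eq1 => /andP[/(tightU lt_j) + /(tightS lt_j)].
rewrite /uniq_sorted des_unsheltered des_sheltered /U /S !size_cat /=.
rewrite size_drop (size_takel (ltnW lt_j)).
by move=> [lt1 ->] [lt2 ->]; split; lia.
Qed.

(** The index enters the two bounds with opposite signs: compared with the equalities at [i], the
    bound for [U j] gives [j <= i] and that for [S j] gives [i <= j]. *)
Lemma hook_unique i j : i < size T -> j < size T ->
  fert (U i) * fert (S i) = 1 -> 0 < fert (U j) * fert (S j) -> j = i.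
Proof.
move=> lt_i lt_j hi hj; have [] := @hook_bounds i lt_i; first by rewrite hi.
have [] := hook_bounds lt_j hj; rewrite hi; lia.
Qed.

Lemma uniq_sorted_hook : uniq_sorted (A ++ v :: B ++ T) =
  \sum_(0 <= j < size T) uniq_sorted (U j) * uniq_sorted (S j) :> nat.
Proof.
rewrite /uniq_sorted fert_decomp // sum_eq1; last exact: hook_unique.
by apply: eq_bigr => j _; rewrite muln_eq1 mulnb.
Qed.

(** Adding the bounds of [hook_bounds] cancels [j], and equality in the sum forces equality in
    both. *)
Lemma tight_hook : tight (A ++ v :: B ++ T).
Proof.
move=> fw; have [j lt_j hj] : exists2 j, j < size T & 0 < fert (U j) * fert (S j).
  move: fw; rewrite fert_decomp // big_mkord lt0n sum_nat_eq0.
  by case/forallPn => j; rewrite implyTb -lt0n => hj; exists j.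
have [ltAj ltBj eqj] := hook_bounds lt_j hj.
rewrite des_descent // !size_cat /= size_cat; split; first by lia.
apply/idP/eqP => [|eqw].
  rewrite /uniq_sorted fert_decomp // big_mkord => /sum_nat_eq1[i [_ hi _]].
  have [//|] := @hook_bounds i (ltn_ord i); first by rewrite hi.
  by rewrite hi; lia.
(* Reading the boolean as [0 < _] turns the goal into positivity of a sum of indicators, for which
   the term at [j] suffices. *)
rewrite /uniq_sorted fert_decomp // -[_ == 1]lt0b sum_eq1; last exact: hook_unique.
rewrite big_mkord (bigD1 (Ordinal lt_j)) //= eqj.
by rewrite addn_gt0 lt0b; apply/orP; left; lia.
Qed.

End HookDecomposition.

(** Induction on length, increasing words being the base: the two words of a hook are shorter
    subsequences of [w]. The empty word has a preimage but fails the strict bound. *)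
Lemma tight_uniq (w : seq nat) : uniq w -> w != [::] -> tight w.
Proof.
have [n] := ubnP (size w); elim: n w => // n IH w lt_n uw w0.
have [sw|[A [v [B [T [Dw B0 ltA ltB pT]]]]]] := tail_split uw.
  move=> _; have [_ /(_ w0)] := fert_sorted sw; rewrite /uniq_sorted => ->.
  have -> : des w = 0.
    case: w sw w0 {lt_n uw} => // x w sw _.
    by rewrite (@des_max_ascend [::] x w).
  by rewrite muln0 add0n lt0n size_eq0; split; rewrite ?w0 1?eq_sym.
have szw : size w = size A + size B + size T + 1.
  by rewrite Dw !size_cat /= size_cat; lia.
rewrite [in tight _]Dw.
apply: tight_hook => // j lt_j; apply: IH.
- by rewrite size_cat /= size_drop; lia.
- apply: subseq_uniq uw; rewrite Dw; apply: cat_subseq => //=; rewrite eqxx.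
  by apply: subseq_trans (suffix_subseq _ _); apply: drop_subseq.
- by case: (A).
- by rewrite size_cat size_take_min; lia.
- apply: subseq_uniq uw; rewrite Dw -cat_rcons.
  apply: subseq_trans (suffix_subseq _ _); apply: cat_subseq => //.
  exact: take_subseq.
- by case: (B) B0.
Qed.

(** * Counting words *)

Lemma stack_sort_map f w : {mono f : x y / x < y} ->
  stack_sort (map f w) = map f (stack_sort w).
Proof.
move=> mono_f; rewrite /stack_sort size_map.
suff H k inp st out : iter k sort_step (map f inp, map f st, map f out) =
    let c := iter k sort_step (inp, st, out) in (map f c.1.1, map f c.1.2, map f c.2).
  by rewrite (H _ w [::] [::]).
elim: k inp st out => [//|k IH] [|x inp] [|y st] out; rewrite !iterSr /= -?map_rcons;
  [exact: (IH [::] [::])|exact: (IH [::])|exact: (IH inp [:: x])|].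
by rewrite mono_f; case: ifP => _; [exact: (IH inp [:: x, y & st])|exact: (IH (x :: inp))].
Qed.

Lemma perm_permutations_map (f : nat -> nat) w : injective f ->
  perm_eq (permutations (map f w)) (map (map f) (permutations w)).
Proof.
move=> inj_f; apply: uniq_perm; rewrite ?(map_inj_uniq (inj_map inj_f)) ?permutations_uniq //.
move=> u; rewrite mem_permutations; apply/idP/mapP => [|[u']].
  move=> /(perm_iotaP 0)[Is]; rewrite size_map => pI ->.
  exists (map (nth 0 w) Is).
    by rewrite mem_permutations; apply/(perm_iotaP 0); exists Is.
  rewrite -map_comp; apply/eq_in_map => i.
  by rewrite (perm_mem pI) mem_iota => /andP[_ lt_i]; rewrite (nth_map 0).
by rewrite mem_permutations => pu ->; apply: perm_map.
Qed.

Lemma ltn_mono_inj (f : nat -> nat) : {mono f : x y / x < y} -> injective f.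
Proof.
by move=> mono_f x y eq_f; case: (ltngtP x y) => //; rewrite -mono_f eq_f ltnn.
Qed.

Lemma fert_map f w : {mono f : x y / x < y} -> fert (map f w) = fert w.
Proof.
move=> mono_f; have inj_f := ltn_mono_inj mono_f.
rewrite /fert (seq.permP (perm_permutations_map _ inj_f)) count_map.
by apply: eq_count => u /=; rewrite stack_sort_map // (inj_eq (inj_map inj_f)).
Qed.

Definition sorted_count (X T : seq nat) : nat :=
  \sum_(A <- permutations X) uniq_sorted (A ++ T).

Lemma sorted_count_map f X T : {mono f : x y / x < y} ->
  sorted_count (map f X) (map f T) = sorted_count X T.
Proof.
move=> mono_f; have inj_f := ltn_mono_inj mono_f.
rewrite /sorted_count (perm_big _ (perm_permutations_map _ inj_f)) big_map.
by apply: eq_bigr => A _; rewrite -map_cat /uniq_sorted fert_map.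
Qed.

Lemma sorted_mono s : sorted ltn s ->
  exists2 f, {mono f : x y / x < y} & s = [seq f i | i <- iota 0 (size s)].
Proof.
(* Past the end of [s] the default exceeds every letter of [s] and grows with [k], which makes [f]
   increasing on all of [nat]. *)
move=> sort_s; pose f k := nth ((last 0 s) + k.+1) s k.
have homo_f : {homo f : x y / x < y}.
  move=> x y lt_xy; rewrite /f; have [le_y|lt_y] := leqP (size s) y.
    rewrite (nth_default _ le_y); have [le_x|lt_x] := leqP (size s) x.
      by rewrite nth_default //; lia.
    have le_last : nth 0 s x <= last 0 s.
      rewrite -nth_last; have := sorted_leq_nth leq_trans leqnn 0.
      by apply; rewrite ?inE; [apply: sub_sorted sort_s => i j; apply: ltnW|lia..].
    by rewrite (set_nth_default 0) //; lia.
  rewrite !(set_nth_default 0 (_ + _)) ?(ltn_trans lt_xy) //.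
  by apply: (sorted_ltn_nth ltn_trans) => //; rewrite inE // (ltn_trans lt_xy).
exists f; first exact/leqW_mono/leq_mono.
apply: (@eq_from_nth _ 0) => [|i lt_i]; first by rewrite size_map size_iota.
by rewrite (nth_map 0) ?size_iota // nth_iota // add0n; apply: set_nth_default.
Qed.

(** Standardization: fertility depends only on the relative order of the letters. *)
Lemma sorted_count_iota X T : sorted ltn (X ++ T) ->
  sorted_count X T =
  sorted_count (iota 1 (size X)) (iota (size X).+1 (size T)).
Proof.
suff H (Y Z : seq nat) : sorted ltn (Y ++ Z) -> sorted_count Y Z =
    sorted_count (iota 0 (size Y)) (iota (size Y) (size Z)).
  move=> sXT; rewrite (H X T) // [RHS]H ?size_iota //.
  by rewrite -add1n -iotaD iota_ltn_sorted.
move=> /sorted_mono[f mono_f]; rewrite size_cat iotaD map_cat add0n => /eqP.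
rewrite eqseq_cat ?size_map ?size_iota // => /andP[/eqP DY /eqP DZ].
rewrite {1}DZ {1}DY.
exact: sorted_count_map.
Qed.

Lemma sum_permutations_drop (s X T : seq nat) (G : seq nat -> nat) :
  perm_eq s (X ++ T) ->
  \sum_(w <- permutations s | drop (size X) w == T) G w =
  \sum_(A <- permutations X) G (A ++ T).
Proof.
move=> ps; rewrite -big_filter -[RHS](big_map (fun A => A ++ T) xpredT).
apply/perm_big/uniq_perm; first exact/filter_uniq/permutations_uniq.
  rewrite map_inj_in_uniq ?permutations_uniq // => A B.
  rewrite !mem_permutations => /perm_size szA /perm_size szB /eqP.
  by rewrite eqseq_cat ?szA // => /andP[/eqP].
move=> w; rewrite mem_filter mem_permutations; apply/andP/mapP => [[/eqP DT pw]|[A]].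
  exists (take (size X) w); last by rewrite -DT cat_take_drop.
  by rewrite mem_permutations -(perm_cat2r T) -{1}DT cat_take_drop (perm_trans pw).
rewrite mem_permutations => pA ->; rewrite -(perm_size pA) drop_size_cat // eqxx.
by split=> //; rewrite perm_sym (perm_trans ps) // perm_cat2r perm_sym.
Qed.

Lemma sum_permutations_cons x (s : seq nat) (G : seq nat -> nat) : x \notin s ->
  \sum_(A <- permutations (x :: s)) G A =
  \sum_(0 <= k < (size s).+1) \sum_(w <- permutations s)
     G (take k w ++ x :: drop k w).
Proof.
move=> x_s.
rewrite -[RHS](big_allpairs_dep (h := fun k w => take k w ++ x :: drop k w) (F := G)).
rewrite /index_iota subn0.
apply/perm_big/uniq_perm; first exact: permutations_uniq.
  apply: allpairs_uniq; rewrite ?iota_uniq ?permutations_uniq // => -[k w] [k' w'].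
  (* The place of insertion is recovered as the index of [x], whence injectivity. *)
  have index_x t i : t \in permutations s -> i \in iota 0 (size s).+1 ->
      index x (take i t ++ x :: drop i t) = i /\ size (take i t) = i.
    rewrite mem_permutations mem_iota add0n ltnS => pt le_i.
    have : x \notin take i t.
      by apply: contra x_s => /mem_take; rewrite (perm_mem pt).
    rewrite index_cat /= eqxx addn0 => /negbTE ->.
    by rewrite size_takel // (perm_size pt).
  move=> /allpairsP[[k1 w1] [k1s w1s [-> ->]]].
  move=> /allpairsP[[k2 w2] [k2s w2s [-> ->]]] /= eq12.
  have [i1 sz1] := index_x w1 k1 w1s k1s; have [i2 sz2] := index_x w2 k2 w2s k2s.
  have ek : k1 = k2 by rewrite -i1 eq12 i2.
  move/eqP: eq12; rewrite eqseq_cat ?sz1 ?sz2 // eqseq_cons => /and3P[/eqP et _ /eqP ed].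
  by rewrite -(cat_take_drop k1 w1) et ed ek cat_take_drop.
move=> u; rewrite mem_permutations; apply/idP/allpairsP => [pu|[[k w] /= [_ +->]]].
  have [|L [R [-> pLR _]]] := @split_max x s u x_s.
    by rewrite (perm_trans pu) // perm_sym perm_rcons.
  exists (size L, L ++ R); split; last by rewrite /= take_size_cat // drop_size_cat.
    by rewrite mem_iota /= -(perm_size pLR) size_cat add0n ltnS leq_addr.
  by rewrite mem_permutations.
rewrite mem_permutations => pw.
by rewrite -cat1s perm_catCA cat1s perm_cons cat_take_drop.
Qed.

(** [tail_length] with the word as a parameter, so that sums over ['S_n] can become sums over
    words. *)
Definition word_tail_length (n : nat) (w : seq nat) : nat :=
  find (fun i => nth 0 w (n - i - 1) != n - i) (iota 0 n).

Lemma leq_tail_length m n w : m <= n -> size w = n ->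
  (m <= word_tail_length n w) = (drop (n - m) w == iota (n - m).+1 m).
Proof.
move=> le_mn szw; rewrite leqNgt -has_take_leq ?size_iota // take_iota.
rewrite -all_predC (minn_idPl le_mn); apply/allP/eqP => [tw|dw i].
  apply: (@eq_from_nth _ 0); rewrite size_drop szw subKn ?size_iota // => k lt_k.
  (* The tail is scanned from the right, so the letter at index [k] of the suffix is tested at
     [m - 1 - k]. *)
  have /tw /= : m - 1 - k \in iota 0 m by rewrite mem_iota; lia.
  rewrite negbK nth_drop nth_iota // => /eqP.
  have -> : n - (m - 1 - k) - 1 = n - m + k by lia.
  by move=> ->; lia.
rewrite mem_iota /= negbK => lt_i.
have -> : n - i - 1 = n - m + (m - 1 - i) by lia.
by rewrite -nth_drop dw nth_iota; lia.
Qed.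

Lemma perm_words n : perm_eq [seq word p | p <- enum 'S_n] (permutations (iota 1 n)).
Proof.
apply: uniq_perm; rewrite ?(map_inj_uniq (@word_inj n)) ?enum_uniq ?permutations_uniq //.
move=> w; rewrite mem_permutations; apply/mapP/idP => [[p _ ->]|/word_onto[p /eqP <-]].
  exact: perm_word.
by exists p; rewrite ?mem_enum.
Qed.

Lemma uniquely_sortedE n (p : 'S_n) : uniquely_sorted p = uniq_sorted (word p).
Proof.
rewrite /uniquely_sorted /uniq_sorted /fert; congr (_ == 1).
rewrite (seq.permP (perm_permutations (perm_word p))) -(seq.permP (perm_words n)).
rewrite count_map cardE -size_filter; congr size.
rewrite {1}/enum_mem -enumT; apply: eq_filter => q /=.
by rewrite !inE -word_stack_sort_perm (inj_eq (@word_inj n)).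
Qed.

Lemma E_count m n : E m n =
  \sum_(w <- permutations (iota 1 n) | word_tail_length n w == m) uniq_sorted w.
Proof.
rewrite -(perm_big _ (perm_words n)) big_map big_enum_cond /=.
rewrite /E -sum1_card big_mkcond [RHS]big_mkcond /=; apply: eq_bigr => p _.
rewrite inE uniquely_sortedE -/(tail_length p).
by case: eqP; case: uniq_sorted.
Qed.

(** By [leq_tail_length], tail length at least [m] means that the last [m] letters are fixed while
    the others are arbitrary. *)
Lemma E_geE m n : m <= n -> E_ge m n = sorted_count (iota 1 (n - m)) (iota (n - m).+1 m).
Proof.
move=> le_mn; have piota : perm_eq (iota 1 n) (iota 1 (n - m) ++ iota (n - m).+1 m).
  by rewrite -add1n -iotaD subnK.
rewrite /sorted_count.
rewrite -(sum_permutations_drop (fun w => nat_of_bool (uniq_sorted w)) piota).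
rewrite size_iota.
rewrite /E_ge; under eq_bigr do rewrite E_count.
transitivity (\sum_(w <- permutations (iota 1 n) | m <= word_tail_length n w)
   uniq_sorted w : nat); last first.
  rewrite big_seq_cond [RHS]big_seq_cond; apply: eq_bigl => w.
  rewrite mem_permutations; case: (boolP (perm_eq _ _)) => //= pw.
  by rewrite leq_tail_length // (perm_size pw) size_iota.
under eq_bigr do rewrite big_mkcond.
rewrite exchange_big [RHS]big_mkcond /=; apply: eq_bigr => w _.
have le_tl : word_tail_length n w <= n.
  by rewrite -{2}(size_iota 0 n); apply: find_size.
case: (leqP m) => [le_m|lt_m]; last first.
  rewrite big_seq big1 // => l; rewrite mem_index_iota => /andP[le_l _].
  by case: eqP => // el; lia.
rewrite (big_rem (word_tail_length n w)) ?mem_index_iota ?le_m ?ltnS //= eqxx.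
rewrite big_seq_cond big1 ?addn0 // => l /andP[].
by rewrite mem_rem_uniq ?iota_uniq // inE eq_sym => /andP[/negbTE ->].
Qed.

(** A word of tail length exactly [m] arises by inserting [v.+1] into a permutation of the smaller
    letters and appending the tail; the place [k = v] is excluded because it would lengthen the
    tail. *)
Lemma E_insert m v : E m (v + m).+1 =
  \sum_(0 <= k < v) \sum_(w <- permutations (iota 1 v))
    uniq_sorted (take k w ++ v.+1 :: drop k w ++ iota v.+2 m).
Proof.
set n := (v + m).+1; have nm : n - m = v.+1 by lia.
have nm1 : n - m.+1 = v by lia.
(* [G] discards the words whose tail is longer than [m]. *)
pose G w := if drop v w != iota v.+1 m.+1 then uniq_sorted w : nat else 0.
have piota : perm_eq (iota 1 n) (iota 1 v.+1 ++ iota v.+2 m).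
  by rewrite -add1n -iotaD addSn.
transitivity (\sum_(w <- permutations (iota 1 n) | drop v.+1 w == iota v.+2 m) G w).
  rewrite E_count big_mkcond [RHS]big_mkcond big_seq [RHS]big_seq.
  apply: eq_bigr => w; rewrite mem_permutations => pw.
  have szw : size w = n by rewrite (perm_size pw) size_iota.
  rewrite /G eqn_leq leqNgt.
  rewrite !leq_tail_length ?nm ?nm1 //; try lia.
  by case: (_ =P iota v.+1 _); case: eqP.
have := sum_permutations_drop G piota; rewrite size_iota => ->.
have pv : perm_eq (iota 1 v.+1) (v.+1 :: iota 1 v).
  by rewrite -{1}(addn1 v) iotaD perm_catC add1n.
rewrite (perm_big _ (perm_permutations pv)) /= sum_permutations_cons; last first.
  by rewrite mem_iota; lia.
have drop_insert k w : k <= v -> w \in permutations (iota 1 v) ->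
    (drop v ((take k w ++ v.+1 :: drop k w) ++ iota v.+2 m) == iota v.+1 m.+1) =
    (k == v).
  rewrite mem_permutations => le_k pw.
  have szw : size w = v by rewrite (perm_size pw) size_iota.
  have szt : size (take k w) = k by rewrite size_takel ?szw.
  rewrite dropl_cat; last by rewrite size_cat szt /= size_drop szw; lia.
  rewrite -(addn1 m) addnC iotaD eqseq_cat; last first.
    by rewrite size_drop size_cat szt /= size_drop szw; lia.
  rewrite addn1 eqxx andbT drop_cat szt ltnNge le_k /=.
  have [->|ne_kv] := eqVneq k v; first by rewrite subnn -szw drop_size szw eqxx.
  have -> : v - k = (v - k).-1.+1 by lia.
  apply/eqP => /= dv; have : v.+1 \in w.
    by apply: (@mem_drop k); apply: (@mem_drop (v - k).-1); rewrite dv mem_head.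
  by rewrite (perm_mem pw) mem_iota; lia.
rewrite size_iota big_nat_recr //= [X in _ + X]big1_seq ?addn0; last first.
  by move=> w /= /(drop_insert v w (leqnn v)); rewrite /G => ->; rewrite eqxx.
rewrite big_seq [RHS]big_seq; apply: eq_bigr => k; rewrite mem_index_iota => /andP[_ lt_k].
rewrite big_seq [RHS]big_seq; apply: eq_bigr => w /(drop_insert k w (ltnW lt_k)).
by rewrite /G => ->; rewrite ltn_eqF //= -catA.
Qed.

(** Permutations are grouped by the set of their first [k] letters. Each of the ['C(v, k)] sets
    contributes [p * q], since both parts are then arranged independently. *)
Lemma sum_permutations_split v k (g h : seq nat -> nat) p q : k <= v ->
  (forall X, sorted ltn X -> all (geq v) X -> size X = k ->
     \sum_(A <- permutations X) g A = p) ->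
  (forall X, sorted ltn X -> all (geq v) X -> size X = v - k ->
     \sum_(A <- permutations X) h A = q) ->
  \sum_(w <- permutations (iota 1 v)) g (take k w) * h (drop k w) =
  'C(v, k) * (p * q).
Proof.
move=> le_k sum_g sum_h.
(* [vals] and [set_of] translate between subsets of ['I_v], which starts at 0, and sets of letters,
   which start at 1. *)
pose vals (X : {set 'I_v}) := [seq (val i).+1 | i <- enum X].
pose set_of (s : seq nat) := [set i : 'I_v | (val i).+1 \in s].
have mem_vals X (i : 'I_v) : ((val i).+1 \in vals X) = (i \in X).
  by rewrite (mem_map (inj_comp succn_inj val_inj)) mem_enum.
have vals_sorted X : sorted ltn (vals X).
  rewrite sorted_map /enum_mem; apply: sorted_filter => [i j l|]; first exact: ltn_trans.
  rewrite -enumT -[sorted _ _]/(sorted (relpre val ltn) _) -sorted_map.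
  by rewrite val_enum_ord iota_ltn_sorted.
have vals_le X : all (geq v) (vals X).
  by apply/allP => _ /mapP[i _ ->] /=.
have size_vals X : size (vals X) = #|X| by rewrite size_map -cardE.
have perm_vals X : perm_eq (vals X ++ vals (~: X)) (iota 1 v).
  have -> : iota 1 v = [seq (val i).+1 | i <- enum 'I_v].
    by rewrite (map_comp succn val) val_enum_ord -(iotaDl 1 0 v).
  rewrite -map_cat; apply: perm_map.
  have -> : enum (~: X) = [seq i <- enum 'I_v | predC (mem X) i].
    by rewrite enumT; apply: eq_filter => i; rewrite !inE.
  by rewrite {1}/enum_mem -enumT perm_filterC.
have set_ofP w X : perm_eq w (iota 1 v) ->
    (set_of (take k w) == X) = perm_eq (take k w) (vals X).
  move=> pw; apply/eqP/idP => [<-|pX].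
    apply: uniq_perm => [||x].
    - by rewrite take_uniq // (perm_uniq pw) iota_uniq.
    - by apply: sorted_uniq (vals_sorted _); [exact: ltn_trans|exact: ltnn].
    apply/idP/idP => [xw|/mapP[i + ->]]; last by rewrite mem_enum inE.
    have : x \in iota 1 v by rewrite -(perm_mem pw) (mem_take xw).
    rewrite mem_iota => /andP[x0 lt_x]; have lt_x1 : x.-1 < v by lia.
    have Dx : x = (val (Ordinal lt_x1)).+1 by rewrite /=; lia.
    by rewrite Dx mem_vals inE -Dx.
  by apply/setP => i; rewrite inE (perm_mem pX) mem_vals.
rewrite (partition_big (fun w => set_of (take k w)) xpredT) //=.
transitivity (\sum_(X : {set 'I_v} | #|X| == k) p * q); last first.
  by rewrite sum_nat_cond_const card_draws card_ord.
rewrite [RHS]big_mkcond; apply: eq_bigr => X _.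
rewrite big_seq_cond; case: eqP => [szX|szX]; last first.
  apply: big_pred0 => w; rewrite mem_permutations; apply/andP => -[pw].
  rewrite set_ofP // => /perm_size; rewrite size_vals size_takel => [/esym //|].
  by rewrite (perm_size pw) size_iota.
rewrite -(sum_g (vals X)) ?size_vals // -(sum_h (vals (~: X))) //; last first.
  by rewrite size_vals cardsCs setCK card_ord szX.
rewrite big_distrl; under [RHS]eq_bigr do rewrite big_distrr.
rewrite /= -big_seq_cond.
(* The words with prefix set [X] are the concatenations of an arrangement of [X] and one of its
   complement. *)
transitivity (\sum_(w <- [seq A ++ B | A <- permutations (vals X),
    B <- permutations (vals (~: X))]) g (take k w) * h (drop k w)); last first.
  rewrite big_allpairs_dep big_seq [RHS]big_seq; apply: eq_bigr => A.
  rewrite mem_permutations => /perm_size; rewrite size_vals szX => szA.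
  by apply: eq_bigr => B _; rewrite take_size_cat ?drop_size_cat.
rewrite -big_filter; apply/perm_big/uniq_perm.
- exact/filter_uniq/permutations_uniq.
- apply: allpairs_uniq; rewrite ?permutations_uniq // => -[A B] [A' B'].
  move=> /allpairsP[[A1 B1] [/= + _ [-> ->]]] /allpairsP[[A2 B2] [/= + _ [-> ->]]].
  rewrite !mem_permutations => /perm_size szA /perm_size szB /= /eqP.
  by rewrite eqseq_cat ?szA // => /andP[/eqP -> /eqP ->].
move=> w; rewrite mem_filter mem_permutations.
apply/andP/allpairsP => [[+ pw]|[[A B] /= [+ + ->]]].
  rewrite set_ofP // => pA; exists (take k w, drop k w).
  rewrite /= !mem_permutations cat_take_drop pA; split=> //.
  rewrite -(perm_cat2l (vals X)); apply: (@perm_trans _ (take k w ++ drop k w)).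
    by rewrite perm_cat2r perm_sym.
  by rewrite cat_take_drop (perm_trans pw) // perm_sym.
rewrite !mem_permutations => pA pB.
have pw : perm_eq (A ++ B) (iota 1 v).
  by apply: perm_trans (perm_vals X); apply: perm_cat.
by rewrite pw set_ofP // take_size_cat // (perm_size pA) size_vals.
Qed.

(** * The recurrence *)

Lemma sorted_countE X T : sorted ltn (X ++ T) ->
  sorted_count X T = E_ge (size T) (size X + size T).
Proof. by move=> sXT; rewrite sorted_count_iota // E_geE ?leq_addl // addnK. Qed.

Lemma sorted_count_above v X T : sorted ltn X -> all (geq v) X ->
  path ltn v T -> sorted_count X T = E_ge (size T) (size X + size T).
Proof.
move=> sX leX pT; apply: sorted_countE.
rewrite sorted_pairwise; last exact: ltn_trans.
rewrite pairwise_cat -!sorted_pairwise; try exact: ltn_trans.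
move: pT; rewrite (path_sortedE ltn_trans) => /andP[/allP gtT sT].
rewrite sX sT !andbT; apply/allrelP => x y /(allP leX) /= le_x /gtT /=.
exact: leq_ltn_trans.
Qed.

(** [uniq_sorted_hook] at the letter [v.+1]; the bound [k < v] makes the part [drop k w] under the
    hook nonempty. *)
Lemma uniq_sorted_insert v m k w : k < v -> perm_eq w (iota 1 v) ->
  uniq_sorted (take k w ++ v.+1 :: drop k w ++ iota v.+2 m) =
  \sum_(0 <= j < m)
     uniq_sorted (take k w ++ v.+1 :: iota (v + j).+3 (m - j.+1)) *
     uniq_sorted (drop k w ++ iota v.+2 j) :> nat.
Proof.
move=> lt_k pw; have szw : size w = v by rewrite (perm_size pw) size_iota.
have ltw : all (ltn^~ v.+1) w.
  by apply/allP => x; rewrite (perm_mem pw) mem_iota /= add1n => /andP[].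
have pT : path ltn v.+1 (iota v.+2 m) := iota_ltn_sorted v.+1 m.+1.
have B0 : drop k w != [::] by rewrite -size_eq0 size_drop szw -lt0n subn_gt0.
have uw : uniq (take k w ++ v.+1 :: drop k w ++ iota v.+2 m).
  have pu : perm_eq (take k w ++ v.+1 :: drop k w ++ iota v.+2 m)
      (iota 1 (v + m.+1)).
    rewrite iotaD add1n -cat1s perm_catCA (catA (take k w)).
    by rewrite cat_take_drop perm_catCA perm_cat2r.
  by rewrite (perm_uniq pu) iota_uniq.
rewrite uniq_sorted_hook ?all_take ?all_drop // ?size_iota.
- rewrite big_seq [RHS]big_seq; apply: eq_bigr => j.
  rewrite mem_index_iota => /andP[_ lt_j].
  rewrite drop_iota take_iota (minn_idPl (ltnW lt_j)).
  by rewrite addSn addSn addnS.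
- move=> j _; apply: tight_uniq; last by case: (take k w).
  apply: subseq_uniq uw; apply: cat_subseq => //=; rewrite eqxx.
  by apply: subseq_trans (suffix_subseq _ _); apply: drop_subseq.
move=> j _; apply: tight_uniq; last by case: (drop k w) B0.
apply: subseq_uniq uw; rewrite -cat_rcons.
apply: subseq_trans (suffix_subseq _ _); apply: cat_subseq => //.
exact: take_subseq.
Qed.

Theorem theorem6p4 :
  (forall m n : nat, m < n ->
     E m n =
       \sum_(1 <= j < m.+1) \sum_(1 <= i < (n - m - 1).+1)
         'C(n - m - 1, i - 1) * E_ge j (i + j - 1) * E_ge (m - j) (n - j - i))
  /\ E 1 1 = 1
  /\ (forall n : nat, 2 <= n -> E n n = 0).
Proof.
(* Tail length [n] leaves only the increasing word, handled by [fert_sorted]. *)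
have E_diag n : 0 < n -> E n n = (n == 1).
  move=> n_gt0; have -> : E n n = E_ge n n by rewrite /E_ge big_nat1.
  rewrite E_geE // subnn /sorted_count /= big_seq1 /= /uniq_sorted.
  have [_ ->] := fert_sorted (iota_ltn_sorted 1 n); rewrite ?size_iota //.
  by rewrite -size_eq0 size_iota -lt0n.
split; last first.
  split=> [|n n_gt1]; first by rewrite E_diag.
  by rewrite E_diag 1?ltnW // gtn_eqF.
(* [v] counts the letters below the hook's letter [n - m]. *)
move=> m n lt_mn; have [v ->] : exists v, n = (v + m).+1.
  by exists (n - m.+1); rewrite -addnS subnK.
have -> : (v + m).+1 - m - 1 = v by lia.
rewrite E_insert.
transitivity (\sum_(0 <= k < v) \sum_(0 <= j < m) \sum_(w <- permutations (iota 1 v))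
    uniq_sorted (take k w ++ v.+1 :: iota (v + j).+3 (m - j.+1)) *
    uniq_sorted (drop k w ++ iota v.+2 j)).
  rewrite big_seq [RHS]big_seq; apply: eq_bigr => k.
  rewrite mem_index_iota => /andP[_ lt_k].
  rewrite exchange_big big_seq [RHS]big_seq /=; apply: eq_bigr => w.
  by rewrite mem_permutations => /(uniq_sorted_insert m lt_k).
(* The word outside the hook ends in [v.+1] and [m - j.+1] larger letters, a tail of [m - j]; this
   is the index [j] of the recurrence, hence the reversal. Its [i] is [k.+1]. *)
rewrite exchange_big big_add1 /= [RHS]big_nat_rev /= add0n.
rewrite big_seq [RHS]big_seq; apply: eq_bigr => j.
rewrite mem_index_iota => /andP[_ lt_j].
rewrite big_add1 /= big_seq [RHS]big_seq; apply: eq_bigr => k.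
rewrite mem_index_iota => /andP[_ lt_k].
rewrite (@sum_permutations_split v k
  (fun A => uniq_sorted (A ++ v.+1 :: iota (v + j).+3 (m - j.+1)))
  (fun B => uniq_sorted (B ++ iota v.+2 j))
  (E_ge (m - j) (k + (m - j))) (E_ge j (v - k + j))) ?(ltnW lt_k) //.
- rewrite mulnA subn1 /= -subSn // subSS.
  by congr (_ * E_ge _ _ * E_ge _ _); lia.
- move=> X sX leX szX; rewrite -/(sorted_count X _) (sorted_count_above sX leX).
    by rewrite /= size_iota szX -subSn // subSS.
  rewrite /= ltnSn; have := iota_ltn_sorted (v + j).+3 (m - j.+1).
  by rewrite (path_sortedE ltn_trans) => ->; rewrite andbT;
    apply/allP => x; rewrite mem_iota /=; lia.
move=> X sX leX szX; rewrite -/(sorted_count X _) (sorted_count_above sX leX).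
  by rewrite size_iota szX.
rewrite (path_sortedE ltn_trans) iota_ltn_sorted andbT.
by apply/allP => x; rewrite mem_iota /=; lia.
Qed.
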